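(* Let $O$ be the trivial knot. For any positive integers $m$ and $n$ with $m \le n-1$, and for any finite type invariant $v^F_m$ of F-order $m$ (of virtual knots), there exists a nontrivial virtual knot $K_n$ such that $$v^F_m(K_n)=v^F_m(O).$$
   Context: A virtual knot diagram is a generic immersed closed plane curve each of whose transverse double points is either a real crossing (with over/under information) or a virtual crossing (with no over/under information). A virtual knot is an equivalence class of virtual knot diagrams modulo generalized Reidemeister moves (the classical Reidemeister moves, the purely virtual Reidemeister moves, and the mixed move in which an arc with only virtual crossings passes a real crossing). Equivalently, a virtual knot is an equivalence class of Gauss diagrams (oriented circles with signed chords directed from over to under) modulo the corresponding Reidemeister moves. The trivial knot is the virtual knot represented by the diagram with no double points; a virtual knot is nontrivial if it is not the trivial knot. A triangle in a virtual knot diagram is a disk in the plane meeting the diagram in three arcs which pairwise cross once, where two of the three crossings are real and one is virtual, and the arc passing through both real crossings is either the over-path at both of them (type $F_o$) or the under-path at both of them (type $F_u$), the other two arcs crossing each other virtually. A forbidden move at a triangle moves the arc containing the two real crossings across the virtual crossing of the other two arcs, keeping the over/under information; in terms of Gauss diagrams it exchanges two adjacent chord endpoints on the circle which are both tails (type $F_o$) or both heads (type $F_u$), keeping chord signs and directions. (Triangles carry a sign $\epsilon=\pm$, and a single forbidden move turns an $\epsilon$-triangle into a $(-\epsilon)$-triangle; the sign plays no further role in the following definition.) Let $\mathcal{VK}$ be the set of virtual knots and let $G$ be an abelian group. An invariant $v:\mathcal{VK}\to G$ is a finite type invariant of F-order $\le n$ if for any virtual knot diagram $D$ and any $n+1$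 disjoint triangles $d_1,\dots,d_{n+1}$ in $D$, $$\sum_{\delta}(-1)^{|\delta|}v(D_\delta)=0,$$ where $\delta=(\delta_1,\dots,\delta_{n+1})$ runs over $(n+1)$-tuples of $0$ and $1$, $|\delta|$ is the number of $1$'s in $\delta$, and $D_\delta$ is the diagram obtained from $D$ by performing a single forbidden move at every triangle $d_i$ with $\delta_i=1$. The invariant $v$ is a finite type invariant of F-order $n$ if it is of F-order $\le n$ but not of F-order $\le n-1$. *)

(* Defs.v *)
(* Mathematical Components, with classical logic from MathComp-Analysis' boolp. *)
From HB Require Import structures.
From mathcomp Require Import all_boot all_order all_algebra.
From mathcomp Require Import generic_quotient boolp.
From Stdlib Require Import Relation_Operators.

Set Implicit Arguments.
Unset Strict Implicit.
Unset Printing Implicit Defensive.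

Import GRing.Theory.
Local Open Scope quotient_scope.
Local Open Scope ring_scope.

(* A Gauss diagram is encoded by the sequence of chord endpoints met when the
   oriented circle is traversed once from a base point.  An endpoint carries
   the name of its chord, whether it is the tail (over) or the head (under) of
   the chord, and the sign of the chord (true for +). *)
Definition endpoint : Type := (nat * bool * bool)%type.
HB.instance Definition _ := Countable.copy endpoint (nat * bool * bool)%type.

Definition chord (x : endpoint) : nat := x.1.1.
Definition tail (x : endpoint) : bool := x.1.2.
Definition sign (x : endpoint) : bool := x.2.

Definition opp_end (x : endpoint) : endpoint := (chord x, ~~ tail x, sign x).

(* Each chord has exactly one tail and one head, which bear the same sign. *)
Definition is_gauss (s : seq endpoint) : bool :=
  uniq [seq (chord x, tail x) | x <- s] && all (fun x => opp_end x \in s) s.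

Record gauss_diagram := GaussDiagram {
  code :> seq endpoint;
  codeP : is_gauss code
}.
HB.instance Definition _ := [isSub for code].
HB.instance Definition _ := [Choice of gauss_diagram by <:].

(* Two endpoints in the given order if [b], in the reverse order otherwise. *)
Definition ordered (b : bool) (x y : endpoint) : seq endpoint :=
  if b then [:: x; y] else [:: y; x].

(* The three strands (top, middle, bottom) of a third Reidemeister move, with
   chords a : top -> middle, b : top -> bottom, c : middle -> bottom of signs
   ea, eb, ec.  If the strands are straight lines directed by vectors T, M, B,
   then ea, eb, ec are the signs of the determinants (T, M), (T, B), (M, B).
   Writing u = + when the top strand meets the middle one before the bottom
   one, the middle strand meets the top one before the bottom one iff
   u * eb * ec = +, and the bottom strand meets the top one before the middle
   one iff u * ea * ec = +.  For an odd number of factors, (+) on booleans is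
   the product of signs. *)
Definition R3_strands (u : bool) (a b c : nat) (ea eb ec : bool) :
    seq (seq endpoint) :=
  [:: ordered u (a, true, ea) (b, true, eb);
      ordered (u (+) eb (+) ec) (a, false, ea) (c, true, ec);
      ordered (u (+) ea (+) ec) (b, false, eb) (c, false, ec)].

(* The virtual and mixed moves do not change the Gauss diagram.  Since both
   sides are Gauss diagrams, the chords named in a move are automatically
   distinct from each other and from the remaining ones. *)
Inductive reidemeister (D D' : gauss_diagram) : Prop :=
| Rotate (k : nat) of code D' = rot k D
| Rename (f : nat -> nat) of injective f
    & code D' = [seq (f (chord x), tail x, sign x) | x <- D]
| R1 (s1 s2 : seq endpoint) (x : endpoint) of
    code D = s1 ++ s2 & code D' = s1 ++ [:: x; opp_end x] ++ s2
| R2 (s1 s2 s3 : seq endpoint) (x y : endpoint) (b : bool) of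
    tail x = tail y & sign x <> sign y
    & code D = s1 ++ s2 ++ s3
    & code D' = s1 ++ [:: x; y] ++ s2 ++ ordered b (opp_end x) (opp_end y) ++ s3
| R3 (s1 s2 s3 s4 p q r : seq endpoint) (u : bool) (a b c : nat)
     (ea eb ec : bool) of
    perm_eq [:: p; q; r] (R3_strands u a b c ea eb ec)
    & code D = s1 ++ p ++ s2 ++ q ++ s3 ++ r ++ s4
    & code D' = s1 ++ rev p ++ s2 ++ rev q ++ s3 ++ rev r ++ s4.

Definition virtually_equiv (D D' : gauss_diagram) : Prop :=
  clos_refl_sym_trans gauss_diagram reidemeister D D'.

Definition vequivb (D D' : gauss_diagram) : bool := `[< virtually_equiv D D' >].

Lemma vequivb_equiv : equiv_class_of vequivb.
Proof.
split=> [D | D E | E D F]; rewrite /vequivb.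
- exact/asboolP/rst_refl.
- by apply/asboolP/asboolP => h; apply: rst_sym.
- by move=> /asboolP h1 /asboolP h2; apply/asboolP; apply: rst_trans h1 h2.
Qed.

Canonical vequivb_rel := EquivRelPack vequivb_equiv.

Definition virtual_knot : Type := {eq_quot vequivb}.
HB.instance Definition _ := Choice.on virtual_knot.
HB.instance Definition _ := Quotient.on virtual_knot.

Definition knot_of (D : gauss_diagram) : virtual_knot := \pi_virtual_knot D.

Lemma knot_of_eq (D D' : gauss_diagram) :
  knot_of D = knot_of D' <-> virtually_equiv D D'.
Proof. by split=> [/eqmodP/asboolP | h] //; apply/eqmodP/asboolP. Qed.

Definition empty_diagram : gauss_diagram := @GaussDiagram [::] isT.

Definition trivial_knot : virtual_knot := knot_of empty_diagram.

(* A triangle is given by the first (along the circle) of two cyclically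
   adjacent endpoints of distinct chords which are both tails or both heads. *)
Definition is_triangle (D : gauss_diagram) (x : endpoint) : bool :=
  [&& x \in code D, tail (next D x) == tail x & chord (next D x) != chord x].

Definition triangle (D : gauss_diagram) : Type := {x : endpoint | is_triangle D x}.

Section Triangles.
Variable D : gauss_diagram.

Definition tri_fst (t : triangle D) : endpoint := val t.
Definition tri_snd (t : triangle D) : endpoint := next D (val t).

(* The two real crossings of the triangle. *)
Definition tri_chords (t : triangle D) : seq nat :=
  [:: chord (tri_fst t); chord (tri_snd t)].

(* Disjoint triangles of a planar diagram have no crossing in common;
   conversely triangles without a common chord can be drawn disjointly. *)
Definition disjoint_triangles (k : nat) (d : 'I_k -> triangle D) : Prop :=
  forall i j : 'I_k, i != j -> ~~ has (mem (tri_chords (d i))) (tri_chords (d j)).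

Definition exchange (t : triangle D) (z : endpoint) : endpoint :=
  if z == tri_fst t then tri_snd t
  else if z == tri_snd t then tri_fst t else z.

(* The code of D_delta.  For disjoint triangles the exchanges commute. *)
Definition forbidden_code (k : nat) (d : 'I_k -> triangle D)
    (delta : {ffun 'I_k -> bool}) : seq endpoint :=
  [seq foldr (fun i => exchange (d i)) z [seq i <- enum 'I_k | delta i] | z <- D].

Lemma exchangeK (t : triangle D) : involutive (exchange t).
Proof.
move=> z; rewrite /exchange.
have [-> | zx] := eqVneq z (tri_fst t); first by rewrite eqxx; case: eqP.
have [-> | zy] := eqVneq z (tri_snd t); first by rewrite eqxx.
by rewrite (negPf zx) (negPf zy).
Qed.

Lemma exchange_in (t : triangle D) (z : endpoint) : z \in code D -> exchange t z \in code D.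
Proof.
have /and3P [tD _ _] := valP t.
by rewrite /exchange; case: eqP => // _; [rewrite mem_next | case: eqP].
Qed.

Lemma gauss_uniq (E : gauss_diagram) : uniq (code E).
Proof. by have /andP [/map_uniq] := codeP E. Qed.

Lemma forbidden_code_perm k (d : 'I_k -> triangle D) delta :
  perm_eq (forbidden_code d delta) (code D).
Proof.
rewrite /forbidden_code; move: [seq _ <- _ | _] => r.
set f := (X in map X).
have fI : injective f.
  move=> z z'; rewrite /f; elim: r {f} => [|i r IHr] //=.
  by move/(inv_inj (exchangeK (d i))); apply: IHr.
have fD z : z \in code D -> f z \in code D.
  by move=> zD; rewrite /f; elim: r {f fI} => //= i r; apply: exchange_in.
have uD := gauss_uniq D.
have ufD : uniq [seq f z | z <- D] by rewrite map_inj_uniq.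
have sfD : {subset [seq f z | z <- D] <= code D}.
  by move=> _ /mapP [z zD ->]; apply: fD.
have [|_ eqi] := uniq_min_size ufD sfD; first by rewrite size_map.
exact: uniq_perm.
Qed.

Lemma forbidden_codeP k (d : 'I_k -> triangle D) delta :
  is_gauss (forbidden_code d delta).
Proof.
have pD := forbidden_code_perm d delta; have /andP [u a] := codeP D.
apply/andP; split; first by rewrite (perm_uniq (perm_map _ pD)).
by rewrite (perm_all _ pD); apply: sub_all a => x; rewrite (perm_mem pD).
Qed.

Definition forbidden_moves k (d : 'I_k -> triangle D)
    (delta : {ffun 'I_k -> bool}) : gauss_diagram :=
  GaussDiagram (forbidden_codeP d delta).

End Triangles.

(* Vanishing of the alternating sums over all families of k disjoint
   triangles; for k = 0 this says v = 0. *)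
Definition F_vanishing (G : zmodType) (v : virtual_knot -> G) (k : nat) : Prop :=
  forall (D : gauss_diagram) (d : 'I_k -> triangle D), disjoint_triangles d ->
    \sum_(delta : {ffun 'I_k -> bool})
      v (knot_of (forbidden_moves d delta)) *~ (-1) ^+ #|[set i | delta i]| = 0.

Definition F_order_le (G : zmodType) (v : virtual_knot -> G) (n : nat) : Prop :=
  F_vanishing v n.+1.

(* "F-order <= n - 1" is vanishing on families of n triangles. *)
Definition F_order (G : zmodType) (v : virtual_knot -> G) (n : nat) : Prop :=
  F_order_le v n /\ ~ F_vanishing v n.

(* Main.v *)
(* A Gauss diagram is built from a cyclic sequence of levels.  The strand of
   level j passes under chords x1, y1, x2, y2 of signs +, +, -, -, that is, it
   is acted upon by the commutator of x and y, where the tails of x1, x2 (of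
   y1, y2) lie just before (just after) the four heads of level j - 1.
   Exchanging the heads of x1 and y1 lets x1, x2 and y1, y2 cancel by second
   Reidemeister moves.  Once level j - 1 has disappeared, x and y lie on the
   same arc, so that y1, x2 and then x1, y2 cancel, exchanged or not.  Hence
   the forbidden move at any nonempty set of levels makes all levels vanish one
   after the other around the cycle, and every invariant of F-order at most m
   takes the same value on the diagram and on the trivial knot as soon as there
   are more than m levels.  In the symmetric group of order 6 the commutator of
   two distinct reflections is again a nontrivial rotation: the diagram has a
   nonconstant Fox 3-colouring when the number of levels is divisible by 3. *)
Require Import Defs.
From mathcomp Require Import all_boot all_order all_algebra.
From mathcomp Require Import ring zify.
From Stdlib Require Import Relation_Operators.

Set Implicit Arguments.
Unset Strict Implicit.
Unset Printing Implicit Defensive.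

Import GRing.Theory.
Local Open Scope ring_scope.

(** * Gauss codes under permutation and removal of a chord *)

Lemma ordered_perm b x y : perm_eq (ordered b x y) [:: x; y].
Proof. by case: b => //=; rewrite (perm_catC [:: y] [:: x]). Qed.

Lemma rev_ordered b x y : rev (ordered b x y) = ordered (~~ b) x y.
Proof. by case: b. Qed.

Lemma gauss_perm s s' : perm_eq s s' -> is_gauss s = is_gauss s'.
Proof.
move=> p; rewrite /is_gauss (perm_uniq (perm_map _ p)) (perm_all _ p).
by congr (_ && _); apply: eq_all => x; rewrite (perm_mem p).
Qed.

(** A third endpoint of the chord would be a tail or a head, hence would repeat the key of [x] or of
    [opp_end x]. *)
Lemma gauss_fresh s x r :
  is_gauss s -> perm_eq s [:: x, opp_end x & r] -> chord x \notin map chord r.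
Proof.
move=> gs p; move: gs; rewrite (gauss_perm p) => /andP [/= /and3P [u1 u2 _] _].
apply/negP => /mapP [z zr e].
have [tz|tz] := boolP (tail z == tail x).
- by move: u1; rewrite inE negb_or => /andP [_ /mapP []]; exists z; rewrite // e (eqP tz).
- move: u2 => /mapP []; exists z; rewrite //= /opp_end /= -e; congr pair.
  by rewrite /tail /=; move: tz; rewrite /tail; case: z.1.2; case: x.1.2.
Qed.

Lemma gauss_remove s x r :
  is_gauss s -> perm_eq s [:: x, opp_end x & r] -> is_gauss r.
Proof.
move=> gs p; have fx := gauss_fresh gs p; move: gs.
rewrite (gauss_perm p) => /andP [/= /and3P [_ _ u] /and3P [_ _ a]].
rewrite /is_gauss u; apply/allP => z zr; move/allP: a => /(_ z zr).
have cz : chord z != chord x.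
  by apply: contraNneq fx => <-; apply: map_f.
by rewrite !inE => /or3P [/eqP h|/eqP h|] //; move: cz;
  rewrite -[chord z]/(chord (opp_end z)) h eqxx.
Qed.

(** * Fox colourings and their invariance under Reidemeister moves *)

Section Colourings.
Variable A : comPzRingType.
Implicit Types (t : nat -> A) (x y : A) (s : seq endpoint).

(* [t c] is the colour of the arc that carries the tail of the chord [c], and
   the result is the colour reached from [x], if the conditions at all tails
   of [s] hold. *)
Fixpoint walk t x s : option A :=
  if s is z :: s' then
    if tail z then if t (chord z) == x then walk t x s' else None
    else walk t (2 * t (chord z) - x) s'
  else Some x.

(* A nonconstant Fox colouring: if every tail has colour [x], so do all arcs. *)
Definition coloured s : Prop :=
  exists t x, walk t x s = Some x /\ has (fun z => t (chord z) != x) s.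

Lemma walk_cat t x s1 s2 :
  walk t x (s1 ++ s2) = obind (fun y => walk t y s2) (walk t x s1).
Proof. by elim: s1 x => //= z s1 IH x; case: tail => //; case: eqP. Qed.

Lemma walk_catl t x s1 s2 y :
  walk t x s1 = Some y -> walk t x (s1 ++ s2) = walk t y s2.
Proof. by rewrite walk_cat => ->. Qed.

Lemma walk_cat_Some t x s1 s2 y : walk t x (s1 ++ s2) = Some y ->
  exists2 z, walk t x s1 = Some z & walk t z s2 = Some y.
Proof. by rewrite walk_cat; case: (walk t x s1) => //= z; exists z. Qed.

Lemma walk_const t x s : all (fun z => t (chord z) == x) s -> walk t x s = Some x.
Proof.
elim: s => //= z s IH /andP [/eqP e a]; rewrite e eqxx.
have -> : 2 * x - x = x by ring.
by rewrite IH // if_same.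
Qed.

Lemma eq_walk t t' x s : {in map chord s, t =1 t'} -> walk t x s = walk t' x s.
Proof.
elim: s x => //= z s IH x e; rewrite e ?inE ?eqxx // !IH //.
- by move=> c cs; rewrite e // inE cs orbT.
- by move=> c cs; rewrite e // inE cs orbT.
Qed.

(** The walk now starts with the colour [y] of the new base point. If all tails had colour [y], the
    walk from there back to the old base point would be constant, so [x = y] and the given colouring
    would be constant too. *)
Lemma coloured_rot k s : coloured s -> coloured (rot k s).
Proof.
case=> t [x [w h]]; have := w; rewrite -{1}(cat_take_drop k s) => w'.
have [y w1 w2] := walk_cat_Some w'.
exists t, y; rewrite {1}/rot walk_cat w2 /= w1; split=> //; rewrite has_rot.
apply: contraLR h; rewrite -!all_predC => a.
have a' : all (fun z => t (chord z) == y) s.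
  by apply: sub_all a => z /=; rewrite negbK.
have /esym: Some x = Some y.
  by move: a'; rewrite -{1}(cat_take_drop k s) all_cat => /andP [_ /walk_const]; rewrite w2.
by case=> <-; apply: sub_all a' => z /= ->.
Qed.

Lemma coloured_rename (f : nat -> nat) s : injective f ->
  coloured [seq (f (chord x), tail x, sign x) | x : endpoint <- s] <-> coloured s.
Proof.
move=> fI; pose g (x : endpoint) : endpoint := (f (chord x), tail x, sign x).
have E t t' x : {in map chord s, t \o f =1 t'} ->
    walk t x (map g s) = walk t' x s.
  move=> e; rewrite -(eq_walk x e); elim: s x {e} => //= z s IH x.
  by rewrite /tail /chord /= !IH.
split=> -[t [x [w h]]].
- exists (t \o f), x; rewrite -(E t) //; split=> //.
  by move: h; rewrite has_map.
(* [t'] transports [t] along an inverse of [f] on the chord names of [s]; the default of [nth] is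
   reached only outside the image of these names. *)
- pose t' d := t (nth 0%N (map chord s) (index d (map f (map chord s)))).
  have e : {in map chord s, t' \o f =1 t}.
    by move=> c cs; rewrite /t' /= index_map // nth_index.
  exists t', x; rewrite (E t' t) //; split=> //.
  rewrite has_map; move/hasP: h => [z zs h]; apply/hasP; exists z => //=.
  by have /= -> := e _ (map_f chord zs).
Qed.

(** The new chord can only take the colour of the arc where it is inserted, and reflection in that
    colour fixes the arc. *)
Lemma coloured_R1 s1 s2 (x : endpoint) : is_gauss (s1 ++ [:: x; opp_end x] ++ s2) ->
  coloured (s1 ++ s2) <-> coloured (s1 ++ [:: x; opp_end x] ++ s2).
Proof.
move=> gs; have fx : chord x \notin map chord (s1 ++ s2).
  by apply: gauss_fresh gs _; rewrite perm_catCA.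
have W t y : t (chord x) = y -> walk t y [:: x; opp_end x] = Some y.
  rewrite /= /opp_end [tail (_, _, _)]/tail /= => ->.
  have e : 2 * y - y = y by ring.
  by case: tail => /=; rewrite ?e eqxx ?e.
split=> -[t [y [w h]]].
- have [z w1 w2] := walk_cat_Some w.
  pose t' c := if c == chord x then z else t c.
  have e : {in map chord (s1 ++ s2), t' =1 t}.
    by move=> c cs; rewrite /t'; case: eqP cs fx => // -> ->.
  have e1 : {in map chord s1, t' =1 t}.
    by move=> c cs; apply: e; rewrite map_cat mem_cat cs.
  have e2 : {in map chord s2, t' =1 t}.
    by move=> c cs; apply: e; rewrite map_cat mem_cat cs orbT.
  exists t', y; split.
    rewrite walk_cat (eq_walk _ e1) w1.
    rewrite -[LHS]/(walk t' z ([:: x; opp_end x] ++ s2)) walk_cat.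
    by rewrite W /= ?(eq_walk _ e2) // /t' eqxx.
  have : has (fun v => t' (chord v) != y) (s1 ++ s2).
    by move/hasP: h => [v vs h]; apply/hasP; exists v; rewrite // e // map_f.
  by rewrite !has_cat orbCA => ->; rewrite orbT.
- have [z w1 /walk_cat_Some [z' w0 w2]] := walk_cat_Some w.
  (* If the head comes first, the tail requires [T = 2 * T - z] for the colour [T] of the chord, so
     [T = z] in any ring. *)
  have [tx e] : t (chord x) = z /\ z' = z.
    move: w0; rewrite /= /opp_end [tail (_, _, _)]/tail /= [chord (_, _, _)]/chord /=.
    case: tail => /=; case: eqP => // e [<-].
      by rewrite e; split=> //; ring.
    have zE : z = 2 * t (chord x) - (2 * t (chord x) - z) by ring.
    move: zE; rewrite -e => ->.
    by split=> //; ring.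
  move: w0 w2; rewrite {}e => w0 w2.
  have w' : walk t y (s1 ++ s2) = Some y by rewrite walk_cat w1.
  exists t, y; split=> //.
  apply: contraLR h; rewrite -!all_predC => a.
  have a' : all (fun v => t (chord v) == y) (s1 ++ s2).
    by apply: sub_all a => v /=; rewrite negbK.
  move: (a'); rewrite all_cat => /andP [/walk_const a1 _].
  move: a1; rewrite w1 => -[zy].
  rewrite all_cat /= [chord (opp_end x)]/chord /= -/(chord x) tx zy eqxx /=.
  by rewrite -all_cat.
Qed.

Lemma walk_ordered t b (x y : endpoint) z :
    tail x = tail y -> t (chord x) = t (chord y) ->
    (tail x -> t (chord x) = z) ->
  walk t z (ordered b x y) = Some z.
Proof.
move=> e ec; have E : 2 * t (chord y) - (2 * t (chord y) - z) = z by ring.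
by case: b => /=; rewrite e ec; case: tail => [/(_ isT) ->|_]; rewrite ?eqxx // E.
Qed.

Lemma walk_ordered_tails t b (x y : endpoint) z z' : tail x -> tail y ->
  walk t z (ordered b x y) = Some z' -> t (chord x) = z /\ t (chord y) = z.
Proof.
by case: b => /= -> ->; case: eqP => // e; case: eqP.
Qed.

(** Both new chords take the colour of the arc carrying their two tails, and the two reflections at
    their heads cancel. If all other chords have the initial colour, so does that arc; hence
    nonconstancy survives the deletion of the two chords. *)
Lemma coloured_R2 b s1 s2 s3 (x y : endpoint) : tail x = tail y ->
  is_gauss (s1 ++ [:: x; y] ++ s2 ++ ordered b (opp_end x) (opp_end y) ++ s3) ->
  coloured (s1 ++ s2 ++ s3) <->
  coloured (s1 ++ [:: x; y] ++ s2 ++ ordered b (opp_end x) (opp_end y) ++ s3).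
Proof.
move=> exy gs; set r := s1 ++ s2 ++ s3; set s := s1 ++ _ in gs *.
have exy' : tail (opp_end x) = tail (opp_end y) by rewrite /tail /= -!/(tail _) exy.
have ps : perm_eq s ([:: x; opp_end x; y; opp_end y] ++ r).
  have p := ordered_perm b (opp_end x) (opp_end y).
  apply/permP => a; have /permP/(_ a) /= := p.
  by rewrite /s /r !count_cat /= => ->; ring.
have fx : chord x \notin map chord [:: y, opp_end y & r] := gauss_fresh gs ps.
have fy : chord y \notin map chord r.
  have : perm_eq s [:: y, opp_end y, x, opp_end x & r].
    by apply: perm_trans ps _; rewrite -!cat_cons (perm_catCA [:: x; _] [:: y; _]).
  by move/(gauss_fresh gs); rewrite /= !inE !negb_or => /and3P [].
split=> -[t [c [w h]]].
- have [z1 w1 w23] := walk_cat_Some w; have [z2 w2 w3] := walk_cat_Some w23.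
  pose z := if tail x then z1 else z2.
  pose t' d := if (d == chord x) || (d == chord y) then z else t d.
  have tx : t' (chord x) = z by rewrite /t' eqxx.
  have ty : t' (chord y) = z by rewrite /t' eqxx orbT.
  have e : {in map chord r, t =1 t'}.
    move=> d dr; rewrite /t'; case: eqP dr fx => [-> dr|_]; first by rewrite /= !inE dr !orbT.
    by case: eqP fy => [-> /negPf ->|].
  have [e1 e2 e3] : [/\ {in map chord s1, t =1 t'}, {in map chord s2, t =1 t'}
      & {in map chord s3, t =1 t'}].
    by split=> d dr; apply: e; rewrite !map_cat !mem_cat dr ?orbT.
  exists t', c; split.
    have q1 : walk t' c s1 = Some z1 by rewrite -(eq_walk _ e1).
    have q2 : walk t' z1 s2 = Some z2 by rewrite -(eq_walk _ e2).
    have qx : walk t' z1 [:: x; y] = Some z1.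
      by apply: (@walk_ordered t' true); rewrite ?tx ?ty // /z => ->.
    have qy : walk t' z2 (ordered b (opp_end x) (opp_end y)) = Some z2.
      apply: walk_ordered; rewrite // -/(chord x) -/(chord y) [t' _]tx ?[t' _]ty //.
      by rewrite /z [tail _]/tail /=; case: tail.
    rewrite (walk_catl _ q1) (walk_catl _ qx) (walk_catl _ q2) (walk_catl _ qy).
    by rewrite -(eq_walk _ e3).
  have : has (fun v => t' (chord v) != c) r.
    by move/hasP: h => [v vs h]; apply/hasP; exists v; rewrite // -e // map_f.
  by move=> hr; rewrite (perm_has _ ps) has_cat; apply/orP; right.
- have [z1 w1 /walk_cat_Some [z1' wp /walk_cat_Some [z2 w2]]] := walk_cat_Some w.
  move=> /walk_cat_Some [z2' wq w3].
  have [T [tx ty tz]] : exists T, [/\ t (chord x) = T, t (chord y) = T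
      & T = if tail x then z1 else z2].
    case tlx: (tail x).
      have [| |e1 e2] := @walk_ordered_tails t true x y _ _ _ _ wp; first by [].
        by rewrite -exy.
      by exists z1.
    have [| |e1 e2] := walk_ordered_tails _ _ wq.
    - by rewrite /tail /= -/(tail x) tlx.
    - by rewrite -exy' /tail /= -/(tail x) tlx.
    by exists z2.
  have ez1 : z1' = z1.
    move: wp; rewrite (@walk_ordered t true) ?tx ?ty //; first by case.
    by rewrite tz => ->.
  have ez2 : z2' = z2.
    move: wq; rewrite (@walk_ordered t b) //; [by case|by rewrite [LHS]tx [RHS]ty|].
    by rewrite [X in _ -> X = _]tx tz /tail /= -/(tail x); case: tail.
  have w' : walk t c r = Some c by rewrite walk_cat w1 /= walk_cat -ez1 w2 /= -ez2.
  exists t, c; split=> //.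
  apply: contraLR h; rewrite -!all_predC => a.
  have a' : all (fun v => t (chord v) == c) r.
    by apply: sub_all a => v /=; rewrite negbK.
  have [/walk_const a1 /walk_const a2] :
      all (fun v => t (chord v) == c) s1 /\ all (fun v => t (chord v) == c) s2.
    by move: a'; rewrite !all_cat => /and3P [].
  have T1 : z1 = c by move: a1; rewrite w1 => -[].
  have T2 : z2 = c by move: a2; rewrite -T1 -ez1 w2 => -[->]; rewrite ez1.
    rewrite (perm_all _ ps) all_cat a andbT /= /opp_end /chord /= -/(chord x) -/(chord y).
  by rewrite tx ty tz T1 T2 if_same eqxx.
Qed.

Lemma R3_perm u a b c ea eb ec : perm_eq (flatten (R3_strands u a b c ea eb ec))
  [:: (c, true, ec); (c, false, ec); (a, true, ea); (a, false, ea);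
      (b, true, eb); (b, false, eb)].
Proof.
apply/permP => f; rewrite /R3_strands /= !count_cat /=.
have E v (x y : endpoint) : count f (ordered v x y) = (f x + f y)%N.
  by have /permP -> := ordered_perm v x y; rewrite /= addn0.
by rewrite !E; ring.
Qed.

(** The tail of [c] passes to the other side of the head of [a] on the middle strand, so its colour
    is reflected in that of the top arc. On the bottom strand this conjugation compensates for the
    exchanged order of the two reflections. *)
Lemma walk_R3_strand t t' u a b c ea eb ec :
  t' a = t a -> t' b = t b -> t a = t b -> t' c = 2 * t a - t c ->
  {in R3_strands u a b c ea eb ec, forall w z, walk t' z (rev w) = walk t z w}.
Proof.
move=> ea' eb' eab ec' w; rewrite !inE => /or3P [] /eqP -> z; rewrite rev_ordered.
- by case: u; rewrite /= /tail /chord /= ea' eb' eab; case: eqP => // ->; rewrite eqxx.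
- have E1 : (2 * t a - t c == z) = (t c == 2 * t a - z).
    by rewrite subr_eq addrC -subr_eq eq_sym.
  have E2 : (2 * t a - t c == 2 * t a - z) = (t c == z).
    by rewrite (inj_eq (addrI _)) (inj_eq oppr_inj).
  case: (u (+) eb (+) ec); rewrite /= /tail /chord /= ea' ec' ?E1 ?E2 //.
- by case: (u (+) ea (+) ec); rewrite /= /tail /chord /= eb' ec' eab; congr Some; ring.
Qed.

Lemma coloured_R3 s1 s2 s3 s4 p q r u a b c ea eb ec :
  perm_eq [:: p; q; r] (R3_strands u a b c ea eb ec) ->
  is_gauss (s1 ++ p ++ s2 ++ q ++ s3 ++ r ++ s4) ->
  coloured (s1 ++ p ++ s2 ++ q ++ s3 ++ r ++ s4) ->
  coloured (s1 ++ rev p ++ s2 ++ rev q ++ s3 ++ rev r ++ s4).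
Proof.
set s := (X in is_gauss X); set s' := (X in _ -> _ -> _ -> coloured X).
move=> pR gs [t [x [w h]]].
set r0 := s1 ++ s2 ++ s3 ++ s4.
have ps : perm_eq s ([:: (c, true, ec); (c, false, ec); (a, true, ea); (a, false, ea);
      (b, true, eb); (b, false, eb)] ++ r0).
  have p1 := perm_trans (perm_flatten pR) (R3_perm u a b c ea eb ec).
  apply: perm_trans (perm_cat p1 (perm_refl r0)).
  by apply/permP => f; rewrite /= cats0 /s /r0 !count_cat; ring.
have := gauss_fresh gs ps; rewrite /= !inE !negb_or -/c /= => /and5P [ca _ cb _ cr].
rewrite -[chord (c, _, _)]/c in ca cb cr.
rewrite -[chord _]/a in ca; rewrite -[chord _]/b in cb.
(* The top strand is one of [p], [q], [r]; its two tails lie on a single arc, whence [t a = t b]. *)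
have top : exists z z', walk t z (ordered u (a, true, ea) (b, true, eb)) = Some z'.
  have tin : ordered u (a, true, ea) (b, true, eb) \in [:: p; q; r].
    by rewrite (perm_mem pR) inE eqxx.
  have [z1 _ /walk_cat_Some [z2 wp]] := walk_cat_Some w.
  move=> /walk_cat_Some [z3 _ /walk_cat_Some [z4 wq]].
  move=> /walk_cat_Some [z5 _ /walk_cat_Some [z6 wr] _].
  move: tin; rewrite !inE => /or3P [] /eqP ->.
  - by exists z1, z2.
  - by exists z3, z4.
  - by exists z5, z6.
case: top => z [z' /walk_ordered_tails [] // ta tb].
rewrite /chord /= in ta tb.
pose t' d := if d == c then 2 * t a - t c else t d.
have ea' : t' a = t a by rewrite /t' eq_sym (negPf ca).
have eb' : t' b = t b by rewrite /t' eq_sym (negPf cb).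
have ec' : t' c = 2 * t a - t c by rewrite /t' eqxx.
have W v : v \in [:: p; q; r] -> forall y, walk t' y (rev v) = walk t y v.
  rewrite (perm_mem pR) => vR; apply: (walk_R3_strand _ _ _ _ vR) => //.
  by rewrite ta tb.
have e : {in map chord r0, t' =1 t}.
  by move=> d dr; rewrite /t'; case: eqP dr cr => // -> ->.
have S v : {subset v <= r0} -> forall y, walk t' y v = walk t y v.
  by move=> vr y; apply: eq_walk => d /mapP [g gv ->]; apply/e/map_f/vr.
have [S1 S2 S3 S4] : [/\ forall y, walk t' y s1 = walk t y s1,
    forall y, walk t' y s2 = walk t y s2, forall y, walk t' y s3 = walk t y s3
  & forall y, walk t' y s4 = walk t y s4].
  by split; apply: S => v vs; rewrite !mem_cat vs ?orbT.
have ss' : s =i s'.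
  by move=> v; rewrite !mem_cat !mem_rev.
exists t', x; split.
  rewrite -w /s /s' !walk_cat S1; case: (walk t x s1) => //= x1.
  rewrite !walk_cat W ?inE ?eqxx //; case: (walk t x1 p) => //= x2.
  rewrite !walk_cat S2; case: (walk t x2 s2) => //= x3.
  rewrite !walk_cat W ?inE ?eqxx ?orbT //; case: (walk t x3 q) => //= x4.
  rewrite !walk_cat S3; case: (walk t x4 s3) => //= x5.
  by rewrite !walk_cat W ?inE ?eqxx ?orbT //; case: (walk t x5 r) => //= x6.
(* A constant new colouring would make [t a] and [t' c] equal to [x], hence also
   [t c = 2 * t a - t' c]. *)
apply: contraLR h; rewrite -!all_predC => al.
have al' : {in s, forall v, t' (chord v) = x}.
  by move=> v; rewrite ss' => /(allP al) /=; rewrite negbK => /eqP.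
apply/allP => v vs /=; rewrite negbK.
have := al' v vs; rewrite {1}/t'; case: eqP => [vc|_ ->] // _.
have : t' a = x by apply: (al' (a, true, ea)); rewrite (perm_mem ps) !inE eqxx !orbT.
have : t' c = x by apply: (al' (c, true, ec)); rewrite (perm_mem ps) !inE eqxx.
rewrite ec' ea' vc => h1 h2; apply/eqP.
have -> : t c = 2 * t a - (2 * t a - t c) by ring.
by rewrite h1 h2; ring.
Qed.

Lemma coloured_reidemeister (D D' : gauss_diagram) :
  reidemeister D D' -> coloured D <-> coloured D'.
Proof.
have gD := codeP D; have gD' := codeP D'.
case=> [k e|f fI e|s1 s2 x e e'|s1 s2 s3 x y b txy _ e e'
       |s1 s2 s3 s4 p q r u a b c ea eb ec pR e e'].
- rewrite e; split; first exact: coloured_rot.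
  by move/(coloured_rot (size (rot k D) - k)); rewrite -/(rotr _ _) rotK.
- by rewrite e coloured_rename.
- by move: gD'; rewrite e e'; apply: coloured_R1.
- by move: gD'; rewrite e e'; apply: coloured_R2.
- move: gD gD'; rewrite e e' => gD gD'; split; first exact: coloured_R3 pR gD.
  (* The inverse move is again a third Reidemeister move: reversing all three strands amounts to
     negating [u]. *)
  rewrite -{2}[p]revK -{2}[q]revK -{2}[r]revK.
  apply: (@coloured_R3 _ _ _ _ _ _ _ (~~ u) a b c ea eb ec) => //.
  have -> : R3_strands (~~ u) a b c ea eb ec = map rev (R3_strands u a b c ea eb ec).
    by case: u {pR e e' gD gD'}; case: ea; case: eb; case: ec.
  exact: (perm_map rev pR).
Qed.

Lemma coloured_virtually_equiv (D D' : gauss_diagram) :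
  virtually_equiv D D' -> coloured D <-> coloured D'.
Proof.
elim=> {D D'} [D D' /coloured_reidemeister //|D //|D D' _ ->|D E F _ -> _ ->] //.
Qed.

(** The empty code has no chord whose colour could differ from the initial one. *)
Lemma coloured_nontrivial (D : gauss_diagram) :
  coloured D -> knot_of D <> trivial_knot.
Proof. by move=> cD /knot_of_eq /coloured_virtually_equiv [/(_ cD) [t [x [_]]]]. Qed.

End Colourings.

(** * Codes that simplify to the empty diagram *)

(** Stated for bare sequences, so that codes can be rewritten without transporting a proof of
    [is_gauss]. *)
Definition trivial_code (s : seq endpoint) : Prop :=
  forall D : gauss_diagram, code D = s -> virtually_equiv D empty_diagram.

Lemma trivial_R2 s1 s2 s3 (x y : endpoint) b :
    tail x = tail y -> sign x <> sign y ->
    trivial_code (s1 ++ s2 ++ s3) ->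
  trivial_code (s1 ++ [:: x; y] ++ s2 ++ ordered b (opp_end x) (opp_end y) ++ s3).
Proof.
move=> txy sxy triv D eD; have gD := codeP D; rewrite eD in gD.
have g' : is_gauss (s1 ++ s2 ++ s3).
  have p1 : perm_eq (s1 ++ [:: x; y] ++ s2 ++ ordered b (opp_end x) (opp_end y) ++ s3)
      [:: x, opp_end x, y, opp_end y & s1 ++ s2 ++ s3].
    have p := ordered_perm b (opp_end x) (opp_end y).
    apply/permP => a; have /permP/(_ a) /= := p.
    by rewrite !count_cat /= !count_cat => ->; ring.
  exact: gauss_remove (gauss_remove gD p1) (perm_refl _).
apply: rst_trans (triv (GaussDiagram g') erefl); apply/rst_sym/rst_step.
exact: R2 txy sxy _ eD.
Qed.

(** Meant for the levels [j - 1] and [j] in the enumeration of all levels: the second order occurs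
    when [j - 1] wraps around to the last level. *)
Lemma split_two (T : eqType) (l : seq T) (p j : T) : p != j -> p \in l -> j \in l ->
  exists l1 l2 l3, l = l1 ++ p :: l2 ++ j :: l3 \/ l = l1 ++ j :: l2 ++ p :: l3.
Proof.
move=> pj /splitPr [l1 l2]; rewrite mem_cat inE eq_sym (negPf pj) /=.
case/orP => /splitPr [l3 l4].
- by exists l3, l4, l2; right; rewrite -catA.
- by exists l1, l3, l4; left.
Qed.

Lemma next_cat (T : eqType) (s1 s2 : seq T) (x y : T) :
  uniq (s1 ++ [:: x, y & s2]) -> next (s1 ++ [:: x, y & s2]) x = y.
Proof.
move=> u; rewrite next_nth mem_cat inE eqxx orbT.
have xs1 : x \notin s1.
  by move: u; rewrite cat_uniq => /and3P [_ /hasPn /(_ x)]; rewrite inE eqxx => /(_ isT).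
case: s1 xs1 {u} => [|z s1] /=; first by rewrite eqxx.
rewrite inE negb_or eq_sym => /andP [/negPf -> xs1].
by rewrite index_cat (negPf xs1) /= eqxx addn0 nth_cat ltnNge leqnSn /= subSnn.
Qed.

(** * The necklace and the removal of its levels *)

Section Necklace.
Variable n : nat.
(** Levels form the cyclic group of integers modulo [n + 3], so [j + 1] and [j - 1] wrap around. *)
Local Notation level := 'I_n.+3.

(* The chords x1, y1, x2, y2 of level [j] are numbered by [r] = 0, 1, 2, 3. *)
Definition letter (j : level) (r : nat) (t : bool) : endpoint :=
  ((4 * j + r)%N, t, (r < 2)%N).

Definition heads (f : pred level) (j : level) : seq endpoint :=
  if f j then [seq letter j r false | r <- [:: 1; 0; 2; 3]%N]
  else [seq letter j r false | r <- [:: 0; 1; 2; 3]%N].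

(* Only the levels in [P] are present, and those in [f] have been exchanged. *)
Definition block (f P : pred level) (j : level) : seq endpoint :=
  (if P (j + 1) then [:: letter (j + 1) 0 true; letter (j + 1) 2 true] else [::])
  ++ (if P j then heads f j else [::])
  ++ (if P (j + 1) then [:: letter (j + 1) 1 true; letter (j + 1) 3 true] else [::]).

Definition necklace (f P : pred level) : seq endpoint :=
  flatten [seq block f P j | j <- enum level].

Lemma letter_eq j j' r r' t t' : (r < 4)%N -> (r' < 4)%N ->
  (letter j r t == letter j' r' t') = [&& j == j', r == r' & t == t'].
Proof.
move=> r4 r4'; rewrite /letter; apply/eqP/and3P => [[e <- _]|[/eqP -> /eqP -> /eqP ->]] //.
have e1 : j = j' :> nat.
  by have := congr1 (divn^~ 4) e; rewrite /= !(mulnC 4) !divnMDl // !divn_small // !addn0.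
split=> //; first by apply/eqP/val_inj.
by move/eqP: e; rewrite e1 eqn_add2l.
Qed.

(** Two second Reidemeister moves suffice. If level [j] is exchanged, its heads read y1, x1, x2, y2:
    the pair x1, x2 cancels, then y1, y2. Otherwise level [j - 1] is absent and the four tails are
    consecutive, in the order x1, x2, y1, y2: the pair y1, x2 cancels, then x1, y2. *)
Lemma trivial_level (f P : pred level) j : P j -> f j || ~~ P (j - 1) ->
  trivial_code (necklace f [pred k | P k & k != j]) -> trivial_code (necklace f P).
Proof.
move=> Pj fP; set P' := [pred k | _ & _].
have pj : j - 1 != j by rewrite -subr_eq0 addrAC subrr sub0r oppr_eq0 oner_neq0.
have jj : j + 1 != j by rewrite -subr_eq0 addrAC subrr add0r oner_neq0.
have j1 : j - 1 + 1 = j by rewrite subrK.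
(* Level [j] has its tails in block [j - 1] and its heads in block [j]; the other blocks do not
   change. *)
have other k : k != j - 1 -> k != j -> block f P' k = block f P k.
  move=> k1 k2; have k1' : k + 1 != j by rewrite eq_sym -subr_eq eq_sym.
  by rewrite /block /P' /= k2 k1' !andbT.
have others l : j - 1 \notin l -> j \notin l ->
    flatten [seq block f P' k | k <- l] = flatten [seq block f P k | k <- l].
  move=> l1 l2; congr flatten; apply/eq_in_map => k kl.
  by apply: other; [apply: contraNneq l1 => <- | apply: contraNneq l2 => <-].
have inl k : k \in enum level by rewrite mem_enum.
have [l1 [l2 [l3 el]]] := split_two pj (inl (j - 1)) (inl j).
have : uniq [:: j - 1, j & l1 ++ l2 ++ l3].
  suff p : perm_eq (enum level) [:: j - 1, j & l1 ++ l2 ++ l3].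
    by rewrite -(perm_uniq p) enum_uniq.
  apply/permP => a.
  by case: el => ->; do !rewrite ?count_cat /=; lia.
rewrite !cons_uniq in_cons !mem_cat !negb_or =>
  /and3P [/and4P [_ p1 p2 p3] /and3P [q1 q2 q3] _].
have [o1 o2 o3] := And3 (others _ p1 q1) (others _ p2 q2) (others _ p3 q3).
pose H := if P (j - 1) then heads f (j - 1) else [::].
pose U := if P (j + 1) then [:: letter (j + 1) 0 true; letter (j + 1) 2 true] else [::].
pose V := if P (j + 1) then [:: letter (j + 1) 1 true; letter (j + 1) 3 true] else [::].
have bp' : block f P' (j - 1) = H.
  by rewrite /block j1 /P' /= eqxx andbF cats0 pj andbT.
have bj' : block f P' j = U ++ V.
  by rewrite /block /P' /= eqxx jj andbF andbT.
have bp : block f P (j - 1) = [:: letter j 0 true; letter j 2 true] ++ H ++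
    [:: letter j 1 true; letter j 3 true].
  by rewrite /block j1 Pj.
have bj : block f P j = U ++ heads f j ++ V by rewrite /block Pj.
have HP : f j \/ f j = false /\ H = [::].
  by move: fP; rewrite /H; case: (f j) => [|/negPf ->]; [left|right].
rewrite /necklace; set X := flatten [seq block f P k | k <- l1] in o1.
set Y := flatten [seq block f P k | k <- l2] in o2.
set Z := flatten [seq block f P k | k <- l3] in o3.
pose t r := letter j r true; pose h r := letter j r false.
have R2' (x y : endpoint) s1 s2 s3 b s : tail x = tail y -> sign x <> sign y ->
    s = s1 ++ [:: x; y] ++ s2 ++ ordered b (opp_end x) (opp_end y) ++ s3 ->
    trivial_code (s1 ++ s2 ++ s3) -> trivial_code s.
  by move=> e1 e2 ->; apply: trivial_R2.
case: el => ->; rewrite !(map_cat, map_cons, flatten_cat) /=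
  !(map_cat, map_cons, flatten_cat) /= o1 o2 o3 bp bj bp' bj' -!catA => triv.
(* Here the tails of level [j] precede its heads; in the second case the heads come first and the
   same pairs cancel. *)
- case: HP triv => [fj|[fj ->]] triv; rewrite /heads fj.
    apply: (@R2' (t 0) (t 2) X (H ++ [:: t 1; t 3] ++ Y ++ U ++ [:: h 1])
      ([:: h 3] ++ V ++ Z) true) => //; first by rewrite -!catA.
    by apply: (@R2' (t 1) (t 3) (X ++ H) (Y ++ U) (V ++ Z) true); rewrite // -!catA.
  apply: (@R2' (t 2) (t 1) (X ++ [:: t 0]) ([:: t 3] ++ Y ++ U ++ [:: h 0])
    ([:: h 3] ++ V ++ Z) false) => //; first by rewrite -!catA.
  by apply: (@R2' (t 0) (t 3) X (Y ++ U) (V ++ Z) true); rewrite // -!catA.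
- case: HP triv => [fj|[fj ->]] triv; rewrite /heads fj.
    apply: (@R2' (h 0) (h 2) (X ++ U ++ [:: h 1]) ([:: h 3] ++ V ++ Y)
      (H ++ [:: t 1; t 3] ++ Z) true) => //; first by rewrite -!catA.
    by apply: (@R2' (h 1) (h 3) (X ++ U) (V ++ Y ++ H) Z true); rewrite // -!catA.
  apply: (@R2' (h 1) (h 2) (X ++ U ++ [:: h 0]) ([:: h 3] ++ V ++ Y ++ [:: t 0])
    ([:: t 3] ++ Z) false) => //; first by rewrite -!catA.
  by apply: (@R2' (h 0) (h 3) (X ++ U) (V ++ Y) Z true); rewrite // -!catA.
Qed.

Lemma eq_necklace (f f' P P' : pred level) :
  f =1 f' -> P =1 P' -> necklace f P = necklace f' P'.
Proof.
move=> ff' PP'; congr flatten; apply: eq_map => j.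
by rewrite /block /heads ff' !PP'.
Qed.

Lemma trivial_necklace (f : pred level) i : f i -> trivial_code (necklace f predT).
Proof.
(* [P k] keeps the levels at cyclic distance at least [k] after [i]. They are removed in the order
   [i], [i + 1], and so on; [m] counts those left. *)
move=> fi; pose P k (j : level) := (k <= nat_of_ord (j - i)%R)%N.
suff T m k : (k + m = n.+3)%N -> trivial_code (necklace f (P k)).
  by rewrite (@eq_necklace f f predT (P 0)) //; apply: (T n.+3).
elim: m k => [|m IH] k km.
  rewrite (@eq_necklace f f _ pred0) //; last first.
    by move=> j; apply/negbTE; rewrite -ltnNge; move: km; rewrite addn0 => ->; apply: ltn_ord.
  rewrite /necklace (_ : map _ _ = [seq [::] | j <- enum level]) //.
  rewrite (_ : flatten _ = [::]); last by elim: (enum level).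
  by move=> D eD; rewrite (_ : D = empty_diagram); [apply: rst_refl|apply: val_inj].
have kn : (k < n.+3)%N by rewrite -km -addSnnS leq_addr.
have vk : (inord k : level) = k :> nat by rewrite inordK.
apply: (@trivial_level _ _ (i + inord k)).
- by rewrite /P addrAC subrr add0r vk.
(* Level [i] can be removed because it is exchanged, each later one because its predecessor has
   gone. *)
- case: k km kn vk => [|k] km kn vk.
    by rewrite (_ : inord 0 = 0) ?addr0 ?fi //; apply: val_inj.
  apply/orP; right; rewrite /P addrAC [i + _]addrC addrK -ltnNge.
  rewrite (_ : inord k.+1 = inord k + 1) ?addrK ?inordK //; first exact: ltnW.
  by apply: ord_inj; rewrite vk /= inordK 1?ltnW // !modn_small // addn1.
- rewrite (@eq_necklace f f _ (P k.+1)) //; first by apply: IH; rewrite addSnnS.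
  move=> j; have jk : (j != i + inord k) = (k != j - i :> nat).
    by rewrite -[X in _ = (X != _)]vk (inj_eq (@ord_inj _)) [in RHS]eq_sym subr_eq addrC.
  by rewrite [LHS]/(_ && _) jk /P ltn_neqAle andbC.
Qed.

Lemma necklaceP z : reflect (exists j r b, (r < 4)%N /\ z = letter j r b)
  (z \in necklace pred0 predT).
Proof.
apply: (iffP flattenP) => [[_ /mapP [j _ ->]]|[j [r [b [r4 ->]]]]].
- rewrite /block /heads /= !in_cons; do ![case/predU1P => [->|]] => //;
    [exists (j + 1), 0 | exists (j + 1), 2 | exists j, 0 | exists j, 1
      | exists j, 2 | exists j, 3 | exists (j + 1), 1 | exists (j + 1), 3];
    by eexists.
- exists (block pred0 predT (if b then j - 1 else j)).
    by apply: map_f; rewrite mem_enum.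
  rewrite /block /heads /= !in_cons; case: b; rewrite ?subrK;
  by case: r r4 => [|[|[|[|]]]] // _; rewrite eqxx ?orbT.
Qed.

(** No key is repeated, by counting: the code has eight endpoints per level and meets all
    [8 * (n + 3)] possible keys. *)
Lemma necklace_gauss : is_gauss (necklace pred0 predT).
Proof.
apply/andP; split; last first.
  apply/allP => z /necklaceP [j [r [b [r4 ->]]]]; apply/necklaceP.
  by exists j, r, (~~ b).
pose keys := [seq (c, b) | c <- iota 0 (4 * n.+3), b <- [:: true; false]].
apply: (@leq_size_uniq _ keys).
- by apply: allpairs_uniq; rewrite ?iota_uniq // => -[? ?] [? ?].
- move=> _ /allpairsP [[c b] [cN _ ->]].
  move: cN; rewrite [(c, b).1]/= mem_iota leq0n add0n => cN.
  have c4 : (c %/ 4 < n.+3)%N by rewrite ltn_divLR // mulnC.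
  apply/mapP; exists (letter (Ordinal c4) (c %% 4) b); last first.
    by rewrite /letter /chord /tail /= mulnC -divn_eq.
  by apply/necklaceP; exists (Ordinal c4), (c %% 4)%N, b; rewrite ltn_mod.
- have sz (l : seq level) :
      sumn [seq size (block pred0 predT j) | j <- l] = (8 * size l)%N.
    by elim: l => //= j l ->; lia.
  by rewrite size_map size_flatten /shape -map_comp sz size_allpairs
     size_iota size_enum_ord /=; lia.
Qed.

Definition necklace_diagram := GaussDiagram necklace_gauss.

Lemma next_necklace j : next (necklace pred0 predT) (letter j 0 false) = letter j 1 false.
Proof.
have u := gauss_uniq necklace_diagram.
have : j \in enum level by rewrite mem_enum.
move/splitPr => e; move: u; rewrite /= /necklace.
case: e => l1 l2; rewrite map_cat flatten_cat /= => u.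
pose s1 := flatten [seq block pred0 predT k | k <- l1] ++
  [:: letter (j + 1) 0 true; letter (j + 1) 2 true].
pose s2 := [seq letter j r false | r <- [:: 2; 3]%N] ++
  [:: letter (j + 1) 1 true; letter (j + 1) 3 true] ++
  flatten [seq block pred0 predT k | k <- l2].
by have := @next_cat _ s1 s2 (letter j 0 false) (letter j 1 false); rewrite /s1 -catA; apply.
Qed.

Lemma necklace_triangle j : is_triangle necklace_diagram (letter j 0 false).
Proof.
apply/and3P; rewrite /= next_necklace; split=> //.
  by apply/necklaceP; exists j, 0, false.
by rewrite /chord /= eqn_add2l.
Qed.

(** * Forbidden moves on the necklace *)

Section Triangles.
Variables (k : nat) (lev : 'I_k -> level).
Hypothesis levI : injective lev.

Definition necklace_triangles (i : 'I_k) : triangle necklace_diagram :=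
  Sub (letter (lev i) 0 false) (necklace_triangle (lev i)).

Lemma tri_fst_necklace i : tri_fst (necklace_triangles i) = letter (lev i) 0 false.
Proof. by []. Qed.

Lemma tri_snd_necklace i : tri_snd (necklace_triangles i) = letter (lev i) 1 false.
Proof. exact: next_necklace. Qed.

Lemma disjoint_necklace_triangles : disjoint_triangles necklace_triangles.
Proof.
move=> i j ij; apply/hasPn => c; rewrite /tri_chords !tri_fst_necklace !tri_snd_necklace.
rewrite !inE /chord /= !addn0 => h; have := inj_eq levI i j; rewrite (negPf ij) -val_eqE /=.
move=> /eqP; case/orP: h => /eqP ->; lia.
Qed.

(** A parity, because an exchange is an involution; this form allows induction over arbitrary lists
    of indices. *)
Definition swapped (r : seq 'I_k) (j : level) : bool := odd (count (fun i => lev i == j) r).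

Lemma exchanges_fixed (r : seq 'I_k) j q t : (q < 4)%N -> t || (1 < q)%N ->
  foldr (fun i => exchange (necklace_triangles i)) (letter j q t) r = letter j q t.
Proof.
move=> q4 tq; elim: r => //= i r ->.
rewrite /exchange tri_fst_necklace tri_snd_necklace !letter_eq //.
case: t tq => [_|/= q1]; first by rewrite !andbF.
by case: q q4 q1 => [|[|q]] // _ _; rewrite !andbF.
Qed.

(** The boolean [b] is read as the number 0 of x1 or 1 of y1, so that each exchange at level [j]
    adds 1 modulo 2. *)
Lemma exchanges_swapped (r : seq 'I_k) j (b : bool) :
  foldr (fun i => exchange (necklace_triangles i)) (letter j b false) r =
  letter j (b (+) swapped r j) false.
Proof.
elim: r => [|i r IH] /=; first by rewrite addbF.
have -> : swapped (i :: r) j = (lev i == j) (+) swapped r j by rewrite /swapped /= oddD oddb.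
rewrite {}IH addbCA; move: (b (+) swapped r j) => b'.
rewrite /exchange tri_fst_necklace tri_snd_necklace !letter_eq //; try by case: b'.
by rewrite [j == _]eq_sym; case: eqVneq => //= <-; case: b'.
Qed.

Lemma exchanges_necklace (r : seq 'I_k) :
  [seq foldr (fun i => exchange (necklace_triangles i)) z r | z <- necklace_diagram]
    = necklace (swapped r) predT.
Proof.
rewrite /= /necklace map_flatten -map_comp; congr flatten; apply: eq_map => j.
rewrite /block /heads /=.
have := exchanges_swapped r j false; rewrite [nat_of_bool _]/= => ->.
have := exchanges_swapped r j true; rewrite [nat_of_bool true]/= => ->.
rewrite !exchanges_fixed //.
by case: (swapped r j).
Qed.

Lemma forbidden_moves_trivial (delta : {ffun 'I_k -> bool}) i : delta i ->
  knot_of (forbidden_moves necklace_triangles delta) = trivial_knot.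
Proof.
move=> di; apply/knot_of_eq.
set r := [seq i <- enum 'I_k | delta i].
apply: (@trivial_necklace (swapped r) (lev i)); last exact: exchanges_necklace.
(* Since [lev] is injective, level [lev i] is exchanged exactly once. *)
rewrite /swapped (@eq_count _ _ (pred1 i)); last by move=> i' /=; rewrite (inj_eq levI).
have ur : uniq r by rewrite filter_uniq ?enum_uniq.
by rewrite (count_uniq_mem _ ur) oddb /r mem_filter di mem_enum.
Qed.

Lemma forbidden_moves0 (delta : {ffun 'I_k -> bool}) : delta =1 xpred0 ->
  forbidden_moves necklace_triangles delta = necklace_diagram.
Proof.
move=> d0; apply: val_inj; rewrite /= /forbidden_code (@eq_filter _ _ pred0) //.
by rewrite filter_pred0 map_id.
Qed.

(** Up to sign, all terms with [delta] nonzero equal [v trivial_knot]. The alternating sum of the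
    constant [v trivial_knot] vanishes as well, and the two sums differ only in the term of the zero
    [delta]. *)
Lemma F_vanishing_necklace (G : zmodType) (v : virtual_knot -> G) :
  (0 < k)%N -> F_vanishing v k -> v (knot_of necklace_diagram) = v trivial_knot.
Proof.
move=> k0 /(_ _ _ disjoint_necklace_triangles) S.
have S1 : \sum_(delta : {ffun 'I_k -> bool})
    v trivial_knot *~ (-1) ^+ #|[set i | delta i]| = 0.
  rewrite -mulrz_sumr (_ : \sum_(delta : {ffun _}) _ = 0) ?mulr0z //.
  (* The sum of the signs is the expansion of a product of [k] factors [1 - 1], which vanishes since
     [k] is positive. *)
  have P0 : \prod_(i < k) \sum_(b : bool) (-1) ^+ b = 0 :> int.
    case: k k0 => // k' _; rewrite big_ord_recl (_ : \sum_(b : bool) _ = 0) ?mul0r //.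
    by rewrite big_bool.
  have := P0; rewrite (bigA_distr_bigA (fun (_ : 'I_k) (b : bool) => (-1) ^+ b : int)).
  rewrite /= => h; rewrite -[RHS]h; apply: eq_bigr => delta _.
  rewrite -prodr_const big_mkcond; apply: eq_bigr => i _.
  by rewrite inE; case: (delta i).
pose d0 : {ffun 'I_k -> bool} := [ffun=> false].
have d0E : d0 =1 xpred0 by move=> i; rewrite ffunE.
have c0 : #|[set i | d0 i]| = 0%N by apply: eq_card0 => i; rewrite inE d0E.
move: S S1; rewrite (bigD1 d0) //= [in X in _ -> X](bigD1 d0) //= !c0 !expr0 !mulr1z.
rewrite forbidden_moves0 // => S S1; apply: (addIr (- v trivial_knot)).
rewrite subrr; move: S1 => /eqP; rewrite addr_eq0 => /eqP ->; rewrite opprK.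
rewrite -[RHS]S; congr (_ + _); apply: eq_bigr => delta dn.
have [i di] : exists i, delta i.
  apply/existsP; apply: contraNT dn; rewrite negb_exists => /forallP h.
  by apply/eqP/ffunP => i; rewrite ffunE; apply/negbTE.
by rewrite (forbidden_moves_trivial di).
Qed.

End Triangles.

(** * A Fox 3-colouring of the necklace *)

Lemma walk_enum (A : comPzRingType) (t : nat -> A) (B : level -> seq endpoint) :
    (forall j : level, walk t j%:R (B j) = Some j.+1%:R) ->
  walk t 0 (flatten [seq B j | j <- enum level]) = Some n.+3%:R.
Proof.
move=> hB; suff W s a : map val s = iota a (size s) ->
    walk t a%:R (flatten [seq B j | j <- s]) = Some (a + size s)%:R.
  by rewrite (W _ 0%N) ?size_enum_ord // val_enum_ord.
elim: s a => [|j s IH] a /=; first by rewrite addn0.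
by case=> <- /IH h; rewrite (walk_catl _ (hB j)) h addnS addSn.
Qed.

Lemma necklace_coloured : (3 %| n.+3)%N -> coloured 'F_3 necklace_diagram.
Proof.
move=> n3; have three0 : 3%:R = 0 :> 'F_3 by apply/eqP.
have N0 : n.+3%:R = 0 :> 'F_3.
  by rewrite -(divnK n3) natrM three0 mulr0.
(* Block [j] is to be entered with colour [j] and left with colour [j + 1]. The tails of x1, x2 of
   level [j] lie at the start of block [j - 1], hence colour [j - 1]; those of y1, y2 lie at its
   end, hence colour [j]. *)
pose t c : 'F_3 := (c %/ 4)%:R - 1 + (odd c)%:R.
have tE j r b : (r < 4)%N -> t (chord (letter j r b)) = j%:R - 1 + (odd r)%:R.
  move=> r4; rewrite /t /letter /chord /= oddD oddM /= mulnC divnMDl //.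
  by rewrite (divn_small r4) addn0.
(* As 3 divides the number of levels, residues modulo 3 are compatible with the wrap-around. *)
have modR a : (a %% n.+3)%:R = a%:R :> 'F_3.
  by rewrite [in RHS](divn_eq a n.+3) natrD natrM N0 mulr0 add0r.
have SR (j : level) : ((j + 1)%R : level)%:R = j%:R + 1 :> 'F_3 by rewrite /= modR natrD modR.
exists t, 0; split; last first.
  apply/hasP; exists (letter 0 0 true); first by apply/necklaceP; exists 0, 0%N, true.
  by rewrite tE.
rewrite -[X in Some X]N0; apply: walk_enum => j.
rewrite /block /heads /= !tE // !SR /= !addr0 addrK subrK -[j.+1%:R]natr1.
(* The four reflections translate the colour by 4, that is, by 1 modulo 3. *)
have -> : 2 * j%:R - (2 * (j%:R - 1) - (2 * j%:R - (2 * (j%:R - 1) - j%:R)))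
    = j%:R + 1 + 3 :> 'F_3 by ring.
by rewrite three0 addr0 !eqxx.
Qed.

End Necklace.

Theorem theorem2 (G : zmodType) (m n : nat) (m_gt0 : (0 < m)%N)
    (n_gt0 : (0 < n)%N) (le_m_n1 : (m <= n - 1)%N)
    (v : virtual_knot -> G) (hv : F_order v m) :
  exists K : virtual_knot, K <> trivial_knot /\ v K = v trivial_knot.
Proof.
(* The number [3 * m + 3] of levels is divisible by 3, as the colouring requires, and leaves room
   for [m + 1] triangles at distinct levels. *)
have mN : (m.+1 <= (3 * m).+3)%N by lia.
exists (knot_of (necklace_diagram (3 * m))); split.
  by apply/coloured_nontrivial/necklace_coloured;
  rewrite -[X in (_ %| X)%N]addn3 dvdn_addr // dvdn_mulr.
have [vm _] := hv.
apply: (@F_vanishing_necklace _ m.+1 (widen_ord mN)) vm => // i j /(congr1 val) /= ij.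
exact: val_inj.
Qed.
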